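(* Let $n\geq 12$ and let $G$ be a connected bicyclic graph on $n$ vertices (i.e. $|E(G)|=n+1$) whose complement $G^c$ is connected. Then $$\lambda(G^c)\geq \lambda\big(G_1(n-5,0)^c\big),$$ with equality if and only if $G\cong G_1(n-5,0)$.
   Context: For a simple graph $H$, $Q(H)=D(H)+A(H)$ is its signless Laplacian matrix ($D(H)$ the diagonal degree matrix, $A(H)$ the adjacency matrix), and $\lambda(H)$ denotes the least eigenvalue of $Q(H)$. $H^c$ denotes the complement of $H$ (same vertex set, two distinct vertices adjacent iff they are non-adjacent in $H$). For nonnegative integers $p,q$, $G_1(p,q)$ is the graph on $p+q+5$ vertices obtained as follows: take the complete bipartite graph $K_{2,3}$ with parts $\{x,w\}$ and $\{a,b,c\}$ (edges $xa,xb,xc,wa,wb,wc$), attach $p$ pendant vertices to $x$ and $q$ pendant vertices to $w$. Thus $G_1(n-5,0)$ is $K_{2,3}$ with $n-5$ pendant vertices attached to one of its two vertices of degree $3$. *)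

(* Defs.v *)
From HB Require Import structures.
From mathcomp Require Import all_boot all_order all_algebra.
From mathcomp Require Import complex.
From mathcomp Require Import classical_sets reals.

Set Implicit Arguments.
Unset Strict Implicit.
Unset Printing Implicit Defensive.

Import Order.TTheory GRing.Theory Num.Theory.

Local Open Scope ring_scope.

Record sgraph := SGraph {
  vertex : finType;
  adj : rel vertex;
  adj_sym : symmetric adj;
  adj_irrefl : irreflexive adj
}.

Definition nvert (G : sgraph) : nat := #|vertex G|.

Definition edges (G : sgraph) : {set {set vertex G}} :=
  ([set [set x.1; x.2] | x in [pred x : vertex G * vertex G | adj x.1 x.2]])%SET.

Definition connected_graph (G : sgraph) : Prop :=
  (0 < nvert G)%N /\ forall u v : vertex G, connect (@adj G) u v.

Definition bicyclic (G : sgraph) : Prop := #|edges G| = (nvert G).+1.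

Definition isomorphic (G H : sgraph) : Prop :=
  exists2 f : vertex G -> vertex H,
    bijective f & forall u v, adj (f u) (f v) = adj u v.

Section Complement.
Variable G : sgraph.

Definition compl_adj : rel (vertex G) := fun u v => (u != v) && ~~ adj u v.

Fact compl_adj_sym : symmetric compl_adj.
Proof. by move=> u v; rewrite /compl_adj eq_sym adj_sym. Qed.

Fact compl_adj_irrefl : irreflexive compl_adj.
Proof. by move=> u; rewrite /compl_adj eqxx. Qed.

Definition compl : sgraph := SGraph compl_adj_sym compl_adj_irrefl.

End Complement.

Definition degree (G : sgraph) (u : vertex G) : nat := #|[pred v | adj u v]|.

Section Matrices.
Variables (R : realType) (G : sgraph).

Definition adjacency_mx : 'M[R]_(nvert G) :=
  \matrix_(i, j) (adj (enum_val i : vertex G) (enum_val j))%:R.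

Definition degree_mx : 'M[R]_(nvert G) :=
  diag_mx (\row_i (degree (enum_val i : vertex G))%:R).

Definition signless_laplacian : 'M[R]_(nvert G) := degree_mx + adjacency_mx.

End Matrices.

(* For a real symmetric matrix of positive size the infimum is attained, by
   [least_eigenvalueP] below. *)
Definition least_eigenvalue (R : realType) (n : nat) (A : 'M[R]_n) : R :=
  inf [set l : R | eigenvalue A l]%classic.

Definition lambda (R : realType) (G : sgraph) : R :=
  least_eigenvalue (signless_laplacian R G).

(* The vertex [inl (inl true)] is x, [inl (inl false)] is w, [inl (inr _)] are
   a, b, c; [inr (inl _)] are the p pendant vertices at x and [inr (inr _)] the
   q pendant vertices at w.  [G1_arc] lists each edge in one direction. *)
Section G1.
Variables p q : nat.

Definition G1_vertex : finType := ((bool + 'I_3) + ('I_p + 'I_q))%type.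

Definition G1_arc (u v : G1_vertex) : bool :=
  match u, v with
  | inl (inl _), inl (inr _) => true
  | inl (inl true), inr (inl _) => true
  | inl (inl false), inr (inr _) => true
  | _, _ => false
  end.

Definition G1_adj : rel G1_vertex := fun u v => G1_arc u v || G1_arc v u.

Fact G1_adj_sym : symmetric G1_adj.
Proof. by move=> u v; rewrite /G1_adj orbC. Qed.

Fact G1_adj_irrefl : irreflexive G1_adj.
Proof. by case=> [[[]|?]|[?|?]]. Qed.

Definition G1 : sgraph := SGraph G1_adj_sym G1_adj_irrefl.

End G1.

Lemma nvert_G1 (p q : nat) : nvert (G1 p q) = (p + q + 5)%N.
Proof. by rewrite /nvert !card_sum card_bool !card_ord addnC. Qed.

Lemma signless_laplacian_sym (R : realType) (G : sgraph) :
  ((signless_laplacian R G)^T = signless_laplacian R G)%R.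
Proof.
apply/matrixP => i j; rewrite !mxE adj_sym eq_sym.
by case: eqP => [->|].
Qed.

Lemma symmetric_eigenvalue_real (R : realType) (n : nat) (A : 'M[R]_n)
  (z : R[i]) :
  A^T = A -> eigenvalue (map_mx (real_complex R) A) z -> z \is Num.real.
Proof.
move=> symA /eigenvalueP[v vA v_n0].
pose w := (map_mx Num.conj v)^T.
have vw_gt0 : 0 < (v *m w) 0 0.
  have [i vi] : exists i, v 0 i != 0.
    by apply/rV0Pn.
  rewrite mxE (bigD1 i) //= ltr_pwDl //.
    by rewrite !mxE -normCK exprn_gt0 // normr_gt0.
  by apply: sumr_ge0 => j _; rewrite !mxE -normCK exprn_ge0.
have Aw : map_mx (real_complex R) A *m w = z^* *: w.
  have /(congr1 (fun M => (map_mx Num.conj M)^T)) := vA.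
  rewrite map_mxM trmx_mul map_mxZ linearZ /= -/w => <-.
  congr (_ *m _); apply/matrixP => i j; rewrite !mxE -{1}symA mxE.
  by rewrite conj_Creal // complex_real.
apply/CrealP/(mulIf (lt0r_neq0 vw_gt0)).
have := mulmxA v (map_mx (real_complex R) A) w.
by rewrite Aw vA -scalemxAr -scalemxAl => /matrixP/(_ 0 0); rewrite !mxE.
Qed.

Lemma least_eigenvalueP (R : realType) (n : nat) (A : 'M[R]_n) :
  (0 < n)%N -> A^T = A ->
  eigenvalue A (least_eigenvalue A) /\
  forall l, eigenvalue A l -> least_eigenvalue A <= l.
Proof.
move=> n_gt0 symA; pose rc := real_complex R.
have [rs rsE] := closed_field_poly_normal (char_poly (map_mx rc A)).
have cn0 : char_poly (map_mx rc A) != 0.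
  by rewrite monic_neq0 // char_poly_monic.
have mem_rs z : (z \in rs) = eigenvalue (map_mx rc A) z.
  by rewrite eigenvalue_root_char rsE rootZ ?lead_coef_eq0 // root_prod_XsubC.
pose s := [seq complex.Re z | z <- rs].
have mem_s l : (l \in s) = eigenvalue A l.
  rewrite -(eigenvalue_map rc) -mem_rs; apply/mapP/idP => [[z zrs ->]|lrs].
    have zR : z \is Num.real.
      by apply: (symmetric_eigenvalue_real symA); rewrite -mem_rs.
    by rewrite /rc /= RRe_real.
  by exists (rc l).
have [m ms lem] : exists2 m, m \in s & forall l, l \in s -> m <= l.
  have [z0 /[!(=^~ mem_rs)] z0rs] := eigenvalue_closed (map_mx rc A) n_gt0.
  have : complex.Re z0 \in s by apply: map_f.
  elim: (s) (complex.Re z0) => // a t IHt x _.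
  case: t IHt => [|b t] IHt.
    by exists a => [|l]; rewrite ?mem_head // inE => /eqP->.
  have [m mt lem] := IHt b (mem_head _ _).
  have [le_am|lt_ma] := leP a m.
    exists a => [|l]; rewrite ?mem_head // inE => /orP[/eqP-> //|/lem].
    exact: le_trans.
  exists m => [|l]; first by rewrite inE mt orbT.
  by rewrite inE => /orP[/eqP->|/lem //]; apply: ltW.
suff -> : least_eigenvalue A = m.
  by rewrite -mem_s; split=> // l; rewrite -mem_s; apply: lem.
apply/eqP; rewrite eq_le /least_eigenvalue; apply/andP; split.
  apply: ge_inf; last by rewrite /= -mem_s.
  by exists m => l /=; rewrite -mem_s; apply: lem.
apply: lb_le_inf; first by exists m; rewrite /= -mem_s.
by move=> l /=; rewrite -mem_s; apply: lem.
Qed.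

(* Main.v *)
(* The signless Laplacian of [G^c] is [(n - 2) I + J - Q(G)], so a lower bound
   on its least eigenvalue is an upper bound on the form
   [sum_(uv in E) (z_u + z_v)^2] against [(n - 2) |z|^2 + (sum z)^2].  All cases
   are separated by the threshold [1 - 1 / (n - 5)].  If all degrees of [G] are
   at most 6, or if some degree lies between 7 and [n - 3], the least eigenvalue
   for [G^c] is at least 1: the first case uses the bound on [Q(G)] by the
   maximum of degree plus average neighbour degree, the second deletes the
   vertex and applies the same bound to the remaining [n + 1 - d] edges.
   Connectedness of [G^c] excludes degree [n - 1].  If [u] has degree [n - 2],
   let [w] be its only non-neighbour, of degree [k].  Then [G - u] has 3 edges,
   so [1 <= k <= 3]; for [k <= 2] the least eigenvalue is at least the
   threshold, and [k = 3] forces [G] to be [G_1(n - 5, 0)], for which an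
   eigenvalue below the threshold is found as a root of a quartic. *)

Require Import Defs.
From mathcomp Require Import all_boot all_order all_algebra.
From mathcomp Require Import reals.
From mathcomp Require Import ring lra zify.
Import Order.TTheory GRing.Theory Num.Theory.
Local Open Scope ring_scope.

(** * Upper bounds for the signless Laplacian form of a relation *)

Section QuadraticForm.
Set Implicit Arguments.
Unset Strict Implicit.
Unset Printing Implicit Defensive.
Context {R : realFieldType} {V : finType}.
Implicit Types (e : rel V) (z : V -> R) (P : pred V).

Definition rdeg e (a : V) : R := \sum_b (e a b)%:R.

(** The sum runs over ordered pairs, so for symmetric [e] an edge [ab] contributes
    [(z a + z b) ^+ 2] in total: this is the form of Q. *)
Definition slform e z : R := \sum_a \sum_b (e a b)%:R * (z a * (z a + z b)).

(** Vertex deletion on the same type: [u] stays as an isolated point, so deletions can be iterated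
    without subtypes. *)
Definition del e (u : V) : rel V := fun a b => [&& e a b, a != u & b != u].

Lemma rdegE e a : rdeg e a = #|[pred b | e a b]|%:R.
Proof.
by rewrite /rdeg -natr_sum -sum1_card [in RHS]big_mkcond.
Qed.

Lemma rdeg_sum1 e a : rdeg e a = \sum_(b | e a b) 1.
Proof. by rewrite [RHS]big_mkcond; apply: eq_bigr => b _; case: (e a b). Qed.

Lemma rdeg_ge0 e a : 0 <= rdeg e a.
Proof. by rewrite rdegE. Qed.

Lemma rdeg_gt0 e a b : e a b -> 0 < rdeg e a.
Proof. by move=> eab; rewrite rdegE ltr0n; apply/card_gt0P; exists b. Qed.

Lemma del_sym e u : symmetric e -> symmetric (del e u).
Proof. by move=> es a b; rewrite /del es [(a != u) && _]andbC. Qed.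

Lemma del_irrefl e u : irreflexive e -> irreflexive (del e u).
Proof. by move=> ei a; rewrite /del ei. Qed.

Lemma sum_del e u (g : V -> V -> R) : symmetric e -> irreflexive e ->
  \sum_a \sum_b (e a b)%:R * g a b =
  \sum_(b | e u b) (g u b + g b u) + \sum_a \sum_b (del e u a b)%:R * g a b.
Proof.
move=> es ei; rewrite (bigD1 u) //= [X in _ = _ + X](bigD1 u) //=.
rewrite [X in _ + (X + _)]big1 => [|b _]; last by rewrite /del eqxx andbF mul0r.
rewrite add0r.
have -> : \sum_(a | a != u) \sum_b (e a b)%:R * g a b =
  \sum_(a | a != u) ((e u a)%:R * g a u + \sum_b (del e u a b)%:R * g a b).
  apply: eq_bigr => a au; rewrite (bigD1 u) //= es; congr (_ + _).
  rewrite [RHS](bigD1 u) //= {1}/del eqxx !andbF mul0r add0r.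
  by apply: eq_bigr => b bu; rewrite /del au bu !andbT.
rewrite big_split addrA; congr (_ + _).
rewrite [in RHS]big_split /=; congr (_ + _).
  by rewrite [RHS]big_mkcond; apply: eq_bigr => b _; case: (e u b); rewrite ?mul1r ?mul0r.
rewrite [LHS]big_mkcond [RHS]big_mkcond; apply: eq_bigr => b _.
by have [->|_] := eqVneq b u; rewrite ?ei //=; case: (e u b); rewrite ?mul1r ?mul0r.
Qed.

Lemma slform_del e u z : symmetric e -> irreflexive e ->
  slform e z = \sum_(b | e u b) (z u + z b) ^+ 2 + slform (del e u) z.
Proof.
move=> es ei; rewrite /slform (sum_del u) //; congr (_ + _).
by apply: eq_bigr => b _; ring.
Qed.

Lemma sum_rdeg_del e u : symmetric e -> irreflexive e ->
  \sum_a rdeg e a = 2 * rdeg e u + \sum_a rdeg (del e u) a.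
Proof.
move=> es ei; have := @sum_del e u (fun _ _ => 1) es ei.
under eq_bigr => a _ do under eq_bigr => b _ do rewrite mulr1.
move=> ->; congr (_ + _); last first.
  by apply: eq_bigr => a _; apply: eq_bigr => b _; rewrite mulr1.
by rewrite sumr_const rdegE -[LHS]mulr_natr.
Qed.

Lemma sum_pred1_mul (c : V) (k : R) : \sum_v (v == c)%:R * k = k.
Proof.
by rewrite (bigD1 c) //= eqxx mul1r big1 ?addr0 // => v /negPf->; rewrite mul0r.
Qed.

(** Cauchy-Schwarz, by expanding the nonnegative double sum of [(z a - z b) ^+ 2]. *)
Lemma sqr_sum_le P z :
  (\sum_(a | P a) z a) ^+ 2 <= #|P|%:R * \sum_(a | P a) z a ^+ 2.
Proof.
have : 0 <= \sum_(a | P a) \sum_(b | P b) (z a - z b) ^+ 2.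
  by apply: sumr_ge0 => a _; apply: sumr_ge0 => b _; apply: sqr_ge0.
under eq_bigr => a _.
  have -> : \sum_(b | P b) (z a - z b) ^+ 2 = #|P|%:R * z a ^+ 2
     + \sum_(b | P b) z b ^+ 2 + (-2 * \sum_(b | P b) z b) * z a.
    rewrite mulr_natl -sumr_const mulr_sumr mulr_suml -!big_split /=.
    by apply: eq_bigr => b _; ring.
  over.
rewrite !big_split /= sumr_const -!mulr_sumr -mulr_natl; nra.
Qed.

(* The Gershgorin-type bound [max (d a + m a)], where [m a] is the average
   degree of the neighbours of [a], comes from weighting each edge by
   [2 z_a z_b <= (d b / d a) z_a ^ 2 + (d a / d b) z_b ^ 2]. *)
Lemma slform_le_degree e z P c : symmetric e -> 0 <= c ->
    (forall a b, e a b -> P a) ->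
    (forall a, \sum_b (e a b)%:R * rdeg e b <= (c - rdeg e a) * rdeg e a) ->
  slform e z <= c * \sum_(a | P a) z a ^+ 2.
Proof.
move=> es c0 eP hc; set d := rdeg e.
pose h a b : R := (e a b)%:R * (d b / d a * z a ^+ 2 / 2).
apply: (@le_trans _ _ (\sum_a \sum_b ((e a b)%:R * z a ^+ 2 + (h a b + h b a)))).
  apply: ler_sum => a _; apply: ler_sum => b _; rewrite /h (es b a).
  case eab: (e a b); rewrite ?mul0r ?addr0 // !mul1r.
  have da : 0 < d a by apply: rdeg_gt0 eab.
  have db : 0 < d b by apply: (@rdeg_gt0 _ _ a); rewrite es.
  have : 0 <= (d b * z a - d a * z b) ^+ 2 / (d a * d b).
    by rewrite divr_ge0 ?sqr_ge0 // mulr_ge0 ?ltW.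
  have -> : (d b * z a - d a * z b) ^+ 2 / (d a * d b) =
     (d b / d a) * z a ^+ 2 + (d a / d b) * z b ^+ 2 - 2 * z a * z b.
    by field; rewrite !gt_eqF.
  by move=> ?; lra.
(* Swapping the two summations moves all of the weight of [h] onto [z a ^+ 2]. *)
have -> : \sum_a \sum_b ((e a b)%:R * z a ^+ 2 + (h a b + h b a)) =
    \sum_a \sum_b ((e a b)%:R * z a ^+ 2 + (h a b + h a b)).
  under eq_bigr do rewrite !big_split; rewrite !big_split /=.
  under [RHS]eq_bigr do rewrite !big_split; rewrite !big_split /=.
  by congr (_ + (_ + _)); rewrite exchange_big.
rewrite mulr_sumr [leRHS]big_mkcond; apply: ler_sum => a _.
have -> : \sum_b ((e a b)%:R * z a ^+ 2 + (h a b + h a b)) =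
   (d a + (\sum_b (e a b)%:R * d b) / d a) * z a ^+ 2.
  rewrite [d a in X in X + _]/d /rdeg mulr_suml -big_split mulr_suml /=.
  by apply: eq_bigr => b _; rewrite /h; move: (d a)^-1 => x; field.
have z2 := sqr_ge0 (z a).
(* Since [0^-1 = 0], an isolated vertex contributes 0 on the left, whether or not it lies in [P];
   any other vertex lies in [P]. *)
have := rdeg_ge0 e a; rewrite le_eqVlt => /orP[/eqP d0|d0].
  by rewrite -/d in d0; rewrite -d0 invr0 mulr0 addr0 mul0r; case: ifP => // _; apply: mulr_ge0.
have -> : P a.
  by move: d0; rewrite rdegE ltr0n => /card_gt0P[b] /eP.
apply: ler_wpM2r => //; rewrite -lerBrDl ler_pdivrMr //; exact: hc.
Qed.

(** Here [m] is the number of edges. Adjacent [a], [b] satisfy [d a + d b <= m + 1], because only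
    the edge [ab] is counted twice; averaging over the neighbours of [a] gives the degree
    condition. *)
Lemma slform_le_edges e z P m : symmetric e -> irreflexive e ->
    (forall a b, e a b -> P a) -> \sum_a rdeg e a = 2 * m ->
  slform e z <= (m + 1) * \sum_(a | P a) z a ^+ 2.
Proof.
move=> es ei eP hm.
have m0 : 0 <= m.
  have : 0 <= \sum_a rdeg e a by apply: sumr_ge0 => a _; apply: rdeg_ge0.
  by lra.
apply: slform_le_degree => // [|a]; first by lra.
rewrite {3}/rdeg mulr_sumr; apply: ler_sum => b _.
case eab: (e a b); rewrite ?mulr0 ?mul0r // mulr1 mul1r.
have nab : b != a by apply: contraTneq eab => ->; rewrite ei.
(* The summand is the full degree at [v = a] and [v = b], and elsewhere counts only edges to [a] or
   [b]. The left side totals [2 (d a + d b - 1)], the right side [2 m]. *)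
suff : \sum_v ((e a v)%:R + (e b v)%:R + (v == a)%:R * (rdeg e a - 1)
              + (v == b)%:R * (rdeg e b - 1)) <= \sum_v rdeg e v.
  rewrite !big_split /= !sum_pred1_mul hm -/(rdeg e a) -/(rdeg e b); lra.
apply: ler_sum => v _.
have [->|va] := eqVneq v a; first by rewrite ei es eab [a == b]eq_sym (negPf nab) /=; lra.
have [->|vb] := eqVneq v b; first by rewrite ei eab /=; lra.
rewrite !mul0r !addr0 {1}/rdeg (bigD1 a) //= (bigD1 b) //= (es a) (es b) addrA.
by rewrite lerDl sumr_ge0.
Qed.

End QuadraticForm.

(** * Lower bounds for the form of the complement, by the degrees of the graph *)

Section ComplementForm.
Set Implicit Arguments.
Unset Strict Implicit.
Unset Printing Implicit Defensive.
Context {R : realFieldType} {V : finType}.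
Implicit Types (z : V -> R) (P : pred V).
Variable e : rel V.
Hypotheses (es : symmetric e) (ei : irreflexive e).

Local Notation n := (#|V|%:R : R).

(* The quadratic form of the signless Laplacian of the complement of [e],
   as [Q(G^c) = (n - 2) I + J - Q(G)]. *)
Definition compl_form z : R :=
  (n - 2) * (\sum_a z a ^+ 2) + (\sum_a z a) ^+ 2 - slform e z.

Lemma sum_nbrs u (F : V -> R) :
  \sum_a F a = F u + \sum_(a | e u a) F a + \sum_(a | (a != u) && ~~ e u a) F a.
Proof.
rewrite (bigD1 u) //= -addrA; congr (_ + _); rewrite (bigID (e u)) /=; congr (_ + _).
by apply: eq_bigl => a; case: eqVneq => // ->; rewrite ei.
Qed.

Lemma card_non_nbrs u :
  #|[pred a | (a != u) && ~~ e u a]|%:R = n - 1 - rdeg e u :> R.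
Proof.
have := sum_nbrs u (fun _ => 1); rewrite !sumr_const -rdegE => ->; lra.
Qed.

Lemma sum_sqr_shift P z x :
  \sum_(b | P b) (x + z b) ^+ 2 =
  #|P|%:R * x ^+ 2 + 2 * x * (\sum_(b | P b) z b) + \sum_(b | P b) z b ^+ 2.
Proof.
rewrite mulr_natl -sumr_const mulr_sumr -!big_split /=.
by apply: eq_bigr => b _; ring.
Qed.

Lemma sum_sqr_ge0 P z : 0 <= \sum_(a | P a) z a ^+ 2.
Proof. by apply: sumr_ge0 => a _; apply: sqr_ge0. Qed.

Hypothesis edges_bicyclic : \sum_a rdeg e a = 2 * (n + 1).

Lemma compl_form_ge_small_degree z : 12 <= n ->
    (forall a, 0 < #|[pred b | e a b]| <= 6)%N ->
  \sum_a z a ^+ 2 <= compl_form z.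
Proof.
move=> n12 hd; have hd1 a : 1 <= rdeg e a :> R.
  by rewrite rdegE ler1n; case/andP: (hd a).
have hd6 a : rdeg e a <= 6 :> R.
  by rewrite rdegE ler_nat; case/andP: (hd a).
suff : slform e z <= (n - 3) * \sum_a z a ^+ 2.
  by rewrite /compl_form; have := sqr_ge0 (\sum_a z a); lra.
apply: slform_le_degree => // [|a]; first lra.
have h1 : \sum_b (e a b)%:R * rdeg e b <= 6 * rdeg e a :> R.
  rewrite {2}/rdeg mulr_sumr; apply: ler_sum => b _.
  by rewrite mulrC; apply: ler_wpM2r.
(* From the total degree [2 (n + 1)] remove [d a], and at least 1 for each of the [n - 1 - d a]
   other non-neighbours of [a]. *)
have h2 : \sum_b (e a b)%:R * rdeg e b <= n + 3.
  have : \sum_b ((e a b)%:R * rdeg e b) <=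
     \sum_b (rdeg e b - (1 - (e a b)%:R) - (b == a)%:R * (rdeg e a - 1)) :> R.
    apply: ler_sum => b _; have := hd1 b.
    have [->|ba] := eqVneq b a; first by rewrite ei /=; lra.
    by case: (e a b) => /=; lra.
  rewrite !big_split /= !sumrN big_split /= sumrN edges_bicyclic.
  rewrite sum_pred1_mul sumr_const -/(rdeg e a).
  lra.
(* [h1] settles degrees 1 and 2, [h2] settles 3 to 6. For [n = 12], [h2] would fail to settle degree
   7. *)
case/andP: (hd a) => _; move: (h1) (h2) (hd1 a); rewrite rdegE.
case: #|_| => [|[|[|[|[|[|[|k]]]]]]] // + + + _; lra.
Qed.

Lemma compl_form_ge_mid_degree z u : 7 <= rdeg e u :> R -> rdeg e u <= n - 3 ->
  \sum_a z a ^+ 2 <= compl_form z.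
Proof.
move=> d7 dn; rewrite /compl_form (slform_del u z) // sum_sqr_shift -rdegE.
have hq : slform (del e u) z <= (n + 2 - rdeg e u) * \sum_(a | a != u) z a ^+ 2.
  have -> : n + 2 - rdeg e u = (n + 1 - rdeg e u) + 1 by ring.
  apply: slform_le_edges; [exact: del_sym|exact: del_irrefl| |].
    by move=> a b /and3P[].
  by have := @sum_rdeg_del R _ _ u es ei; rewrite edges_bicyclic => h; lra.
have hT := sqr_sum_le [pred a | (a != u) && ~~ e u a] z.
rewrite card_non_nbrs /= in hT.
rewrite !(sum_nbrs u).
have hq2 : \sum_(a | a != u) z a ^+ 2 =
  \sum_(a | e u a) z a ^+ 2 + \sum_(a | (a != u) && ~~ e u a) z a ^+ 2.
  by apply: (addrI (z u ^+ 2)); rewrite addrA -sum_nbrs [RHS](bigD1 u).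
rewrite hq2 in hq.
have := sum_sqr_ge0 (e u) z.
have := sum_sqr_ge0 [pred a | (a != u) && ~~ e u a] z => /=.
move: hq hT d7 dn.
move: (\sum_(a | e u a) z a ^+ 2) (\sum_(a | _ && _) z a ^+ 2) => b2 t2.
move: (\sum_(a | e u a) z a) (\sum_(a | _ && _) z a) => B T.
move: (slform _ z) (rdeg e u) (z u) => q d x hq hT d7 dn t20 b20.
pose r := n - 2 - d; have r1 : 1 <= r by rewrite /r; lra.
(* Multiplying by [r] completes the square in [x]. There are [r + 1] non-neighbours, so
   [T ^+ 2 <= (r + 1) t2 <= 2 r t2]; the last inequality uses [1 <= r]. *)
have key : 0 <= r * x ^+ 2 + 2 * x * T + 2 * t2.
  have r0 : 0 < r by lra.
  rewrite -(pmulr_rge0 _ r0).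
  have -> : r * (r * x ^+ 2 + 2 * x * T + 2 * t2) =
    (r * x + T) ^+ 2 + ((n - 1 - d) * t2 - T ^+ 2) + (r - 1) * t2 by rewrite /r; ring.
  apply: addr_ge0; last by rewrite mulr_ge0 ?subr_ge0.
  by apply: addr_ge0; rewrite ?sqr_ge0 ?subr_ge0.
have := sqr_ge0 (B + T).
have : 0 <= (d - 7) * (b2 + t2) by rewrite mulr_ge0; lra.
by move: key hq; rewrite /r; lra.
Qed.

Lemma del_nonadj u w : u != w -> e w u = false -> del e u w =1 e w.
Proof.
move=> uw ewu b; rewrite /del eq_sym uw /=.
by have [->|_] := eqVneq b u; rewrite ?ewu ?andbT.
Qed.

Section LargeDegree.
Variables u w : V.
Hypotheses (uw : u != w) (eu : forall b, e u b = (b != u) && (b != w)).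

Local Notation N := [pred a | e w a].
Local Notation T := [pred a | (a != w) && ~~ e w a & a != u].

Lemma nonadj_large : e w u = false.
Proof. by rewrite es eu eqxx andbF. Qed.

Lemma sum_split_large (F : V -> R) : \sum_a F a =
  F u + F w + \sum_(a | N a) F a + \sum_(a | T a) F a.
Proof.
rewrite (sum_nbrs w) [X in _ + X](bigD1 u) ?uw ?nonadj_large //=.
by rewrite addrCA !addrA.
Qed.

Lemma sum_nbrs_large (F : V -> R) : \sum_(a | e u a) F a =
  \sum_(a | N a) F a + \sum_(a | T a) F a.
Proof.
have := sum_split_large F.
rewrite (sum_nbrs u) [X in _ + X = _](big_pred1 w); first lra.
by move=> a /=; rewrite eu; case: (eqVneq a u) => [->|_] /=; rewrite ?(negPf uw) ?negbK.
Qed.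

Lemma rdeg_large : rdeg e u = n - 2.
Proof.
have -> : n = \sum_(a : V) 1 by rewrite sumr_const.
by rewrite rdeg_sum1 sum_nbrs_large sum_split_large; ring.
Qed.

Lemma card_common_large : #|T|%:R = n - 2 - rdeg e w.
Proof.
have -> : n = \sum_(a : V) 1 by rewrite sumr_const.
have -> : #|T|%:R = \sum_(a | T a) 1 :> R by rewrite sumr_const.
by rewrite rdeg_sum1 sum_split_large; ring.
Qed.

Lemma rdeg_del_large : rdeg (del e u) w = rdeg e w :> R.
Proof. by apply: eq_bigr => b _; rewrite (del_nonadj uw nonadj_large). Qed.

Lemma sum_rdeg_del_large : \sum_a rdeg (del (del e u) w) a = 2 * (3 - rdeg e w) :> R.
Proof.
have := @sum_rdeg_del R _ _ w (@del_sym _ e u es) (@del_irrefl _ e u ei).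
have := @sum_rdeg_del R _ _ u es ei.
by rewrite edges_bicyclic rdeg_del_large rdeg_large => h1 h2; lra.
Qed.

Lemma compl_form_ge_large_degree z : 12 <= n ->
    (0 < #|[pred b | e w b]| <= 2)%N ->
  (1 - (n - 5)^-1) * (\sum_a z a ^+ 2) <= compl_form z.
Proof.
move=> n12 hk; have delw := del_nonadj uw nonadj_large.
have dels := @del_sym _ e u es; have deli := @del_irrefl _ e u ei.
have hN : rdeg e w = #|N|%:R :> R by rewrite rdegE.
have hq : slform (del (del e u) w) z <= (4 - rdeg e w) *
    (\sum_(a | N a) z a ^+ 2 + \sum_(a | T a) z a ^+ 2).
  rewrite -sum_nbrs_large; have -> : 4 - rdeg e w = (3 - rdeg e w) + 1 :> R by ring.
  apply: slform_le_edges; [exact: del_sym|exact: del_irrefl| |].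
    by move=> a b /and3P[/and3P[_ au _] aw _]; rewrite eu au.
  exact: sum_rdeg_del_large.
rewrite /compl_form (slform_del u z) // (slform_del w z) //.
rewrite !sum_sqr_shift -(rdegE e u) rdeg_large.
have -> : #|[eta del e u w]|%:R = rdeg e w :> R by rewrite -rdeg_del_large rdegE.
rewrite !(eq_bigl _ _ delw) !sum_nbrs_large !sum_split_large.
have cN := sqr_sum_le N z; have cT := sqr_sum_le T z.
rewrite card_common_large in cT; rewrite -hN in cN.
have k1 : 1 <= rdeg e w :> R by rewrite hN ler1n; case/andP: hk.
have k2 : rdeg e w <= 2 :> R by rewrite hN ler_nat; case/andP: hk.
have := sum_sqr_ge0 N z; have := sum_sqr_ge0 T z.
move: hq cN cT k1 k2.
move: (\sum_(a | N a) z a ^+ 2) (\sum_(a | T a) z a ^+ 2) => b2 t2.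
move: (\sum_(a | N a) z a) (\sum_(a | T a) z a) => B S.
move: (slform _ z) (rdeg e w) (z u) (z w) => q k x y hq cN cT k1 k2 t20 b20.
have n0 : n - 5 != 0 by rewrite gt_eqF //; lra.
set s := (n - 5)^-1.
have s0 : 0 < s by rewrite invr_gt0; lra.
have sn : s * n = 1 + 5 * s by rewrite /s; field.
have key1 : 0 <= s * x ^+ 2 + 2 * x * y + (n - 5) * y ^+ 2.
  have -> : s * x ^+ 2 + 2 * x * y + (n - 5) * y ^+ 2 = s * (x + (n - 5) * y) ^+ 2.
    by rewrite /s; field.
  by rewrite mulr_ge0 ?sqr_ge0 ?ltW.
have p1 : 0 <= (2 + s - k) * y ^+ 2 by rewrite mulr_ge0 ?sqr_ge0 //; lra.
have p2 : 0 <= s * (b2 + t2) by rewrite mulr_ge0 //; lra.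
have p3 : 0 <= (2 - k) * b2 by rewrite mulr_ge0 //; lra.
have p4 : 0 <= (k - 1) * t2 by rewrite mulr_ge0 //; lra.
have p5 : 0 <= (n - 12) * b2 by rewrite mulr_ge0 //; lra.
have p6 : 0 <= (n - 12) * t2 by rewrite mulr_ge0 //; lra.
have p7 := sqr_ge0 (y + S).
have p8 := sqr_ge0 (3 * B + S).
by lra.
Qed.

End LargeDegree.

End ComplementForm.

Section Graphs.
Set Implicit Arguments.
Unset Strict Implicit.
Unset Printing Implicit Defensive.
Context {R : realType}.
Implicit Types G H : sgraph.

Lemma sum_rdeg_edges G :
  \sum_a rdeg (@adj G) a = 2 * #|edges G|%:R :> R.
Proof.
pose p (x : vertex G * vertex G) : {set vertex G} := [set x.1; x.2]%SET.
have -> : \sum_a rdeg (@adj G) a = #|[pred x : vertex G * vertex G | adj x.1 x.2]|%:R :> R.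
  rewrite -sum1_card natr_sum pair_bigA /= [RHS]big_mkcond.
  by apply: eq_bigr => x _; rewrite inE; case: (adj _ _).
rewrite -natrM; congr _%:R.
rewrite -[LHS]sum1_card (partition_big_imset p) /= -/(edges G).
rewrite mulnC -sum_nat_const; apply: eq_bigr => _ /imsetP[[a b] /= ab ->].
have nab : a != b by apply: contraTneq ab => ->; rewrite inE /= adj_irrefl.
have -> : 2%N = #|[set (a, b); (b, a)]%SET|.
  by rewrite cards2 xpair_eqE negb_and nab.
rewrite -sum1_card; apply: eq_bigl => -[c d]; rewrite !inE /= !xpair_eqE /p /=.
apply/andP/orP => [[cd /eqP E]|].
  have ca : c \in [set a; b]%SET by rewrite -E !inE eqxx.
  have da : d \in [set a; b]%SET by rewrite -E !inE eqxx orbT.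
  have ncd : c != d by apply: contraTneq cd => ->; rewrite adj_irrefl.
  by move: ca da ncd; rewrite !inE => /orP[]/eqP-> /orP[]/eqP->; rewrite ?eqxx //; auto.
rewrite inE /= in ab.
by case=> /andP[/eqP-> /eqP->]; rewrite ?eqxx // adj_sym ab setUC eqxx.
Qed.

Definition eigenfunction H (l : R) (z : vertex H -> R) : Prop :=
  forall u, \sum_v (adj u v)%:R * (z u + z v) = l * z u.

Lemma sum_enum_val (T : finType) (F : T -> R) :
  \sum_(i < #|T|) F (enum_val i) = \sum_x F x.
Proof. by rewrite -(big_enum_val F). Qed.

Lemma signless_laplacian_rowE H (v : 'rV[R]_(nvert H)) j :
  (v *m signless_laplacian R H) 0 j =
  \sum_w (adj (enum_val j) w)%:R * (v 0 j + v 0 (enum_rank w)).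
Proof.
rewrite /signless_laplacian mulmxDr mxE [_ *m degree_mx _ _]mul_mx_diag !mxE.
under [RHS]eq_bigr do rewrite mulrDr.
rewrite big_split -mulr_suml /=; congr (_ + _).
  by rewrite mulrC -/(rdeg _ _) rdegE.
rewrite -[RHS]sum_enum_val; apply: eq_bigr => i _.
by rewrite !mxE enum_valK adj_sym mulrC.
Qed.

Lemma eigenvalueP_fun H l :
  eigenvalue (signless_laplacian R H) l <->
  exists2 z, @eigenfunction H l z & exists u, z u != 0.
Proof.
split=> [/eigenvalueP[v vl v0]|[z zl [u zu]]].
  exists (fun u => v 0 (enum_rank u)).
    move=> u; have /rowP/(_ (enum_rank u)) := vl.
    by rewrite signless_laplacian_rowE enum_rankK mxE.
  by have /rV0Pn[i vi] := v0; exists (enum_val i); rewrite enum_valK.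
apply/eigenvalueP; exists (\row_i z (enum_val i)); last first.
  by apply/rV0Pn; exists (enum_rank u); rewrite mxE enum_rankK.
apply/rowP => j; rewrite signless_laplacian_rowE !mxE -zl.
by apply: eq_bigr => w _; rewrite mxE enum_rankK.
Qed.

Lemma lambda_le H l z u : @eigenfunction H l z -> z u != 0 -> lambda R H <= l.
Proof.
move=> zl zu; have n0 : (0 < nvert H)%N by apply/card_gt0P; exists u.
have [_] := least_eigenvalueP n0 (signless_laplacian_sym R H).
by apply; apply/eigenvalueP_fun; exists z => //; exists u.
Qed.

Lemma lambda_eigenfunction H : (0 < nvert H)%N ->
  exists2 z, eigenfunction (lambda R H) z & exists u : vertex H, z u != 0.
Proof.
move=> n0; have [h _] := least_eigenvalueP n0 (signless_laplacian_sym R H).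
exact/eigenvalueP_fun.
Qed.

Lemma isomorphic_sym G H : isomorphic G H -> isomorphic H G.
Proof.
move=> [f [g fK gK] fa]; exists g; first by exists f.
by move=> u v; rewrite -fa !gK.
Qed.

Lemma isomorphic_compl G H : isomorphic G H -> isomorphic (compl G) (compl H).
Proof.
move=> [f fb fa]; exists f => // u v.
by rewrite /= /compl_adj fa (inj_eq (bij_inj fb)).
Qed.

Lemma isomorphic_lambda_le G H : (0 < nvert H)%N -> isomorphic G H ->
  lambda R G <= lambda R H.
Proof.
move=> n0 [f fb fa]; have [z zl [u zu]] := lambda_eigenfunction n0.
have [g fK gK] := fb.
apply: (@lambda_le _ _ (z \o f) (g u)); last by rewrite /= gK.
move=> v; rewrite /= -zl (reindex f) /=; last by exists g => ? _.
by apply: eq_bigr => w _; rewrite fa.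
Qed.

Lemma compl_form_eigenfunction G l z : @eigenfunction (compl G) l z ->
  compl_form (@adj G) z = l * \sum_a z a ^+ 2.
Proof.
move=> zl.
have -> : l * \sum_a z a ^+ 2 =
    \sum_a \sum_b (@adj (compl G) a b)%:R * (z a * (z a + z b)).
  rewrite mulr_sumr; apply: eq_bigr => a _.
  rewrite expr2 mulrA -zl mulr_suml; apply: eq_bigr => b _; ring.
have -> : \sum_a \sum_b (@adj (compl G) a b)%:R * (z a * (z a + z b)) =
   \sum_a \sum_b (z a * (z a + z b) - (b == a)%:R * (2 * z a ^+ 2)
      - (@adj G a b)%:R * (z a * (z a + z b))).
  apply: eq_bigr => a _; apply: eq_bigr => b _; rewrite /= /compl_adj eq_sym.
  have [->|_] := eqVneq b a; first by rewrite adj_irrefl /=; ring.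
  by case: (@adj G a b) => /=; ring.
rewrite /compl_form -[X in X - _](_ : \sum_a \sum_b (z a * (z a + z b) - (b == a)%:R * (2 * z a ^+ 2)) = _).
  by rewrite /slform -sumrB; apply: eq_bigr => a _; rewrite -sumrB.
under eq_bigr => a _.
  rewrite sumrB sum_pred1_mul -mulr_sumr big_split /= sumr_const -[z a *+ _]mulr_natr.
  have -> : z a * (z a * #|vertex G|%:R + \sum_i z i) - 2 * z a ^+ 2 =
     (#|vertex G|%:R - 2) * z a ^+ 2 + z a * \sum_i z i by ring.
  over.
by rewrite big_split /= -mulr_sumr -mulr_suml expr2.
Qed.

Lemma lambda_compl_ge G c : (0 < nvert G)%N ->
    (forall z, c * \sum_a z a ^+ 2 <= compl_form (@adj G) z) ->
  c <= lambda R (compl G).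
Proof.
move=> n0 hc; have [z zl [u zu]] := @lambda_eigenfunction (compl G) n0.
have := hc z; rewrite (compl_form_eigenfunction zl) ler_pM2r //.
rewrite (bigD1 u) //= ltr_pwDl ?sum_sqr_ge0 //.
by rewrite lt_def sqrf_eq0 zu sqr_ge0.
Qed.

Lemma connected_graph_nbr G u : connected_graph G -> (1 < nvert G)%N ->
  exists v : vertex G, adj u v.
Proof.
move=> [_ cG] n1.
have [v vu] : exists v, v != u.
  have : (0 < #|predC1 u|)%N by rewrite cardC1; rewrite /nvert in n1; lia.
  by case/card_gt0P => v; exists v.
have /connectP[[|w p] /= pth E] := cG u v; first by rewrite E eqxx in vu.
by exists w; case/andP: pth.
Qed.

Lemma sum_neq_const m (i : 'I_m) (c : R) :
  \sum_(j < m) (i != j)%:R * c = (m%:R - 1) * c.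
Proof.
have -> : (m%:R - 1) * c = \sum_(j < m) (c - (j == i)%:R * c).
  by rewrite sumrB sum_pred1_mul sumr_const card_ord -mulr_natl; ring.
by apply: eq_bigr => j _; rewrite eq_sym; case: (j == i) => /=; ring.
Qed.

Lemma G1_compl_eigenfunction p (l w a b : R) :
    1 + w = l -> (w + 1) + p%:R * (w + b) = l * w ->
    4 * a + p%:R * (a + b) = l * a ->
    (b + w) + 3 * (b + a) + (p%:R - 1) * (2 * b) = l * b ->
  @eigenfunction (compl (G1 p 0)) l (fun v => match v with
    | inl (inl s) => if s then 1 else w
    | inl (inr _) => a
    | inr _ => b
    end).
Proof.
move=> hx hw ha hb u.
rewrite !big_sumType big_bool big_ord0 /= addr0.
case: u => [[[]|i]|[i|[]]] //=; rewrite /compl_adj /G1_adj /=.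
- rewrite !big1 => [|j _|j _]; rewrite ?mul0r //; lra.
- by rewrite big1 => [|j _]; rewrite ?mul0r // sumr_const card_ord -[_ *+ p]mulr_natl; lra.
- have -> : \sum_(j < 3)
      (((inl (inr i) : G1_vertex p 0) != inl (inr j)) && true)%:R * (a + a) =
    (3 - 1) * (a + a) by rewrite -(sum_neq_const i); apply: eq_bigr => j _; rewrite andbT.
  by rewrite sumr_const card_ord -[_ *+ p]mulr_natl; lra.
- have -> : \sum_(j < p)
      (((inr (inl i) : G1_vertex p 0) != inr (inl j)) && true)%:R * (b + b) =
    (p%:R - 1) * (b + b) by rewrite -(sum_neq_const i); apply: eq_bigr => j _; rewrite andbT.
  by rewrite sumr_const card_ord -[_ *+ 3]mulr_natl; lra.
Qed.

(* Eliminating the other entries from the eigenvalue equations of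
   [G1_compl_eigenfunction], with [1] at the vertex x, leaves a quartic in [l]
   which is positive at [0] and negative at [1 - p^-1]. *)
Lemma lambda_compl_G1_lt p : (7 <= p)%N ->
  lambda R (compl (G1 p 0)) < 1 - p%:R^-1.
Proof.
move=> p7; have : 7 <= p%:R :> R by rewrite ler_nat.
set N : R := p%:R => N7.
pose f : {poly R} := (((N + 1)%:P - 'X) * (1 - 'X) - 1)
    * (((2 * N + 2)%:P - 'X) * ((N + 4)%:P - 'X) - (3 * N)%:P)
  - (1 - 'X) * N%:P * ((N + 4)%:P - 'X).
have fE l : f.[l] = ((N + 1 - l) * (1 - l) - 1)
    * ((2 * N + 2 - l) * (N + 4 - l) - 3 * N) - (1 - l) * N * (N + 4 - l).
  by rewrite !hornerE.
have N0 : N != 0 by rewrite gt_eqF //; lra.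
set s := N^-1; have sN : s * N = 1 by rewrite mulVf.
have s0 : 0 < s by rewrite invr_gt0; lra.
have s1 : s <= 7^-1 by rewrite lef_pV2 ?posrE //; lra.
have ft : f.[1 - s] < 0.
  have -> : f.[1 - s] = - N - 1 + 3 * s + 6 * s ^+ 2 + 4 * s ^+ 3 + s ^+ 4.
    by rewrite fE /s; field.
  have : s ^+ 2 <= 1 by rewrite expr_le1 //; lra.
  have : s ^+ 3 <= 1 by rewrite expr_le1 //; lra.
  have : s ^+ 4 <= 1 by rewrite expr_le1 //; lra.
  have : s ^+ 2 <= s / 7 by rewrite expr2 ler_wpM2l // ltW.
  lra.
have f0 : 0 < f.[0].
  have -> : f.[0] = 2 * N * (N + 1) * (N + 2) by rewrite fE; ring.
  by rewrite !mulr_gt0 //; lra.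
have [l /andP[l0 l1] /rootP fl] : exists2 l, 0 <= l <= 1 - s & root (- f) l.
  by apply: poly_ivt; rewrite ?hornerN ?oppr_ge0 ?oppr_le0 ?(ltW f0) ?(ltW ft) //; lra.
have {}fl : f.[l] = 0 by apply/eqP; rewrite -oppr_eq0 -hornerN fl.
have lt_l : l < 1 - s.
  by rewrite lt_neqAle l1 andbT; apply: contraTneq ft => <-; rewrite fl ltxx.
apply: le_lt_trans lt_l.
pose w := l - 1; pose b := (l * w - w - 1) / N - w; pose a := - N * b / (N + 4 - l).
have D0 : N + 4 - l != 0 by rewrite gt_eqF //; lra.
have hx : 1 + w = l by rewrite /w; ring.
have hw : w + 1 + N * (w + b) = l * w by rewrite /b; field.
have ha : 4 * a + N * (a + b) = l * a by rewrite /a; field.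
have hb : b + w + 3 * (b + a) + (N - 1) * (2 * b) = l * b.
  apply/eqP; rewrite -subr_eq0; apply/eqP.
  have -> : b + w + 3 * (b + a) + (N - 1) * (2 * b) - l * b =
    f.[l] / (N * (N + 4 - l)) by rewrite fE /a /b /w; field; rewrite D0 N0.
  by rewrite fl mul0r.
exact: (@lambda_le (compl (G1 p 0)) l _ (inl (inl true))
  (G1_compl_eigenfunction hx hw ha hb) (oner_neq0 R)).
Qed.

End Graphs.

Section Extremal.
Set Implicit Arguments.
Unset Strict Implicit.
Unset Printing Implicit Defensive.
Context {R : realType}.
Variable G : sgraph.
Implicit Types u w : vertex G.

Local Notation e := (@adj G).
Local Notation n := (nvert G).

Lemma isomorphic_G1 u w : (5 <= n)%N -> u != w ->
    (forall b, e u b = (b != u) && (b != w)) ->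
    #|[pred a | e w a]| = 3%N ->
    #|[pred a | (a != w) && ~~ e w a & a != u]| = (n - 5)%N ->
    (forall a b, del (del e u) w a b = false) ->
  isomorphic G (G1 (n - 5) 0).
Proof.
move=> n5 uw eu cN cT e0; apply: isomorphic_sym.
have ewu : e w u = false by rewrite adj_sym eu eqxx andbF.
pose f (v : G1_vertex (n - 5) 0) : vertex G := match v with
  | inl (inl s) => if s then u else w
  | inl (inr i) => enum_val (cast_ord (esym cN) i)
  | inr (inl j) => enum_val (cast_ord (esym cT) j)
  | inr (inr _) => u
  end.
have wN i : e w (f (inl (inr i))) by have := enum_valP (cast_ord (esym cN) i).
have Nu i : (f (inl (inr i)) == u) = false.
  by apply: contraTF (wN i) => /eqP->; rewrite ewu.
have Nw i : (f (inl (inr i)) == w) = false.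
  by apply: contraTF (wN i) => /eqP->; rewrite adj_irrefl.
have [Tw wT Tu] : [/\ forall j, (f (inr (inl j)) == w) = false,
    forall j, e w (f (inr (inl j))) = false &
    forall j, (f (inr (inl j)) == u) = false].
  by split=> j; have /andP[/andP[/negPf ? /negPf ?] /negPf ?] :=
    enum_valP (cast_ord (esym cT) j).
have NT i j : f (inl (inr i)) == f (inr (inl j)) = false.
  by apply: contraTF (wN i) => /eqP->; rewrite wT.
have nadj a b : a != u -> a != w -> b != u -> b != w -> e a b = false.
  by move=> au aw bu bw; have := e0 a b; rewrite /del au aw bu bw !andbT.
have f_inj : injective f.
  have wu : (w == u) = false by rewrite eq_sym (negPf uw).
  move=> [[[]|i]|[i|[]//]] [[[]|j]|[j|[]//]] // /eqP.
  - by rewrite (negPf uw).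
  - by rewrite eq_sym Nu.
  - by rewrite eq_sym Tu.
  - by rewrite /f wu.
  - by rewrite eq_sym Nw.
  - by rewrite eq_sym Tw.
  - by rewrite Nu.
  - by rewrite Nw.
  - by move=> /eqP/enum_val_inj/cast_ord_inj->.
  - by rewrite NT.
  - by rewrite Tu.
  - by rewrite Tw.
  - by rewrite eq_sym NT.
  - by move=> /eqP/enum_val_inj/cast_ord_inj->.
exists f.
  apply: inj_card_bij => //.
  have := nvert_G1 (n - 5) 0; rewrite /nvert => ->.
  by rewrite addn0 subnK.
have wT' j : e (f (inr (inl j))) w = false by rewrite adj_sym wT.
have wN' j : e (f (inl (inr j))) w = true by rewrite adj_sym wN.
have uN j : e u (f (inl (inr j))) = true by rewrite eu Nu Nw.
have uT j : e u (f (inr (inl j))) = true by rewrite eu Tu Tw.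
have uN' j : e (f (inl (inr j))) u = true by rewrite adj_sym.
have uT' j : e (f (inr (inl j))) u = true by rewrite adj_sym.
have euw : e u w = false by rewrite adj_sym.
move=> [[[]|i]|[i|[]//]] [[[]|j]|[j|[]//]] //; rewrite ?adj_irrefl //;
  first [exact: euw | exact: ewu | exact: wN | exact: wN' | exact: wT | exact: wT'
    | exact: uN | exact: uN' | exact: uT | exact: uT'
    | by apply: nadj; rewrite ?Nu ?Nw ?Tu ?Tw].
Qed.

Hypotheses (n12 : (12 <= n)%N) (cG : connected_graph G) (bG : bicyclic G).
Hypothesis cGc : connected_graph (compl G).

Lemma isomorphic_G1_or_lambda_lt :
  isomorphic G (G1 (n - 5) 0) \/
  lambda R (compl (G1 (n - 5) 0)) < lambda R (compl G).
Proof.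
have es : symmetric e := @adj_sym G; have ei : irreflexive e := @adj_irrefl G.
have n1 : (1 < n)%N by lia.
have n0 : (0 < n)%N by lia.
have N12 : 12 <= #|vertex G|%:R :> R by rewrite (ler_nat _ 12).
have hE : \sum_a rdeg e a = 2 * (#|vertex G|%:R + 1) :> R.
  by rewrite sum_rdeg_edges bG natr1.
have d0 a : (0 < #|[pred b | e a b]|)%N.
  by have [b ab] := connected_graph_nbr a cG n1; apply/card_gt0P; exists b.
have lt_G1 : lambda R (compl (G1 (n - 5) 0)) < 1 - (#|vertex G|%:R - 5)^-1.
  have -> : #|vertex G|%:R - 5 = (n - 5)%:R :> R by rewrite natrB //; lia.
  by apply: lambda_compl_G1_lt; lia.
have s_gt0 : 0 < (#|vertex G|%:R - 5)^-1 :> R by rewrite invr_gt0; lra.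
have ge1 : 1 <= lambda R (compl G) ->
  lambda R (compl (G1 (n - 5) 0)) < lambda R (compl G) by lra.
case: (boolP [forall a, #|[pred b | e a b]| <= 6]%N) => [/forallP d6|].
  right; apply: ge1; apply: lambda_compl_ge => // z; rewrite mul1r.
  by apply: compl_form_ge_small_degree => // a; rewrite d0 d6.
rewrite negb_forall => /existsP[u]; rewrite -ltnNge => d7.
have D7 : 7 <= rdeg e u :> R by rewrite rdegE ler_nat.
have c := card_non_nbrs (R := R) ei u.
set T := #|[pred a | (a != u) && ~~ e u a]| in c.
have T0 : (0 < T)%N.
  have [b] := connected_graph_nbr (G := compl G) u cGc n1.
  by rewrite /= /compl_adj eq_sym => ub; apply/card_gt0P; exists b.
have [T2|T1] := ltnP 1 T.
  right; apply: ge1; apply: lambda_compl_ge => // z; rewrite mul1r.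
  apply: (compl_form_ge_mid_degree es ei hE z D7).
  have : 2 <= T%:R :> R by rewrite ler_nat.
  by rewrite c; lra.
have /mem_card1[w hw] : #|[pred a | (a != u) && ~~ e u a]| = 1%N by rewrite -/T; lia.
have := hw w; rewrite !inE eqxx => /andP[wu _].
have uw : u != w by rewrite eq_sym.
have eu b : e u b = (b != u) && (b != w).
  have := hw b; rewrite !inE; have [->|_] := eqVneq b u; first by rewrite ei.
  by move=> /= <-; rewrite negbK.
have hdel := sum_rdeg_del_large es ei hE uw eu.
have dk := rdegE (R := R) e w.
have [k2|k3] := leqP #|[pred b | e w b]| 2.
  right; apply: lt_le_trans lt_G1 _; apply: lambda_compl_ge => // z.
  by apply: (compl_form_ge_large_degree es ei hE uw eu) => //; rewrite d0.
left.
have K3 : 3 <= rdeg e w :> R by rewrite dk ler_nat.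
have hdel0 : 0 <= \sum_a rdeg (del (del e u) w) a :> R.
  by apply: sumr_ge0 => a _; apply: rdeg_ge0.
have kE : rdeg e w = 3 :> R by lra.
apply: (isomorphic_G1 _ uw eu); first lia.
- by apply/eqP; rewrite -(eqr_nat R) -dk kE.
- apply/eqP; rewrite -(eqr_nat R) (card_common_large es ei uw eu) kE natrB; last lia.
  by rewrite /nvert; apply/eqP; ring.
move=> a b; apply/negP => ab; move: hdel0; rewrite hdel kE subrr mulr0.
have : 0 < \sum_a rdeg (del (del e u) w) a :> R.
  by rewrite (bigD1 a) //= ltr_pwDl ?(rdeg_gt0 ab) // sumr_ge0 // => c0 _; apply: rdeg_ge0.
by rewrite hdel kE; lra.
Qed.

End Extremal.

Theorem theorem2p11 (R : realType) (n : nat) (G : sgraph) :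
  (12 <= n)%N -> nvert G = n -> connected_graph G -> bicyclic G ->
  connected_graph (compl G) ->
  lambda R (compl (G1 (n - 5) 0)) <= lambda R (compl G) /\
  (lambda R (compl G) = lambda R (compl (G1 (n - 5) 0)) <->
   isomorphic G (G1 (n - 5) 0)).
Proof.
move=> n12 nG cG bG cGc; subst n.
have iso_eq : isomorphic G (G1 (nvert G - 5) 0) ->
    lambda R (compl G) = lambda R (compl (G1 (nvert G - 5) 0)).
  move=> iso; apply/eqP; rewrite eq_le.
  have isoc := isomorphic_compl iso.
  rewrite isomorphic_lambda_le //=; last first.
    by rewrite [nvert _]nvert_G1 addn_gt0 orbT.
  apply: isomorphic_lambda_le; last exact: isomorphic_sym.
  by case: cGc.
have [iso|lt] := isomorphic_G1_or_lambda_lt (R := R) n12 cG bG cGc.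
  by rewrite iso_eq //; split.
split; first exact: ltW.
by split=> // E; rewrite E ltxx in lt.
Qed.
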